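(* Let $m$ be an odd positive integer, $\ell=5m$, and let $(\mathbf a,\mathbf b)$ be a Legendre pair of length $\ell$ with $\sum_{i=0}^{\ell-1}a_i=\sum_{i=0}^{\ell-1}b_i=1$. Let $\mathcal A_m$ and $\mathcal B_m$ be the $m$-compressions of $\mathbf a$ and $\mathbf b$. Then there exist integers $n_1,n_2\ge 0$ with $n_1+n_2=2\ell+2$ and an integer $x$ such that, for $r=1,2,3,4$, $$\mathrm{PSD}_{\mathbf a}(rm)=n_1+(-1)^{\lfloor r/2\rfloor}\sqrt5\,x,\qquad \mathrm{PSD}_{\mathbf b}(rm)=n_2-(-1)^{\lfloor r/2\rfloor}\sqrt5\,x,$$ where $$x=\frac{\mathrm{PAF}_{\mathcal A_m}(1)-\mathrm{PAF}_{\mathcal A_m}(2)}{2}=-\frac{\mathrm{PAF}_{\mathcal B_m}(1)-\mathrm{PAF}_{\mathcal B_m}(2)}{2}.$$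
   Context: For $\mathbf a\in\mathbb{R}^N$ indexed by $\mathbb{Z}_N$: $\mathrm{PAF}_{\mathbf a}(j)=\sum_{i=0}^{N-1}a_i a_{i-j}$ (indices mod $N$), $\mathrm{DFT}_{\mathbf a}(j)=\sum_{r=0}^{N-1}e^{2\pi i jr/N}a_r$, and $\mathrm{PSD}_{\mathbf a}(j)=|\mathrm{DFT}_{\mathbf a}(j)|^2$. A pair $(\mathbf a,\mathbf b)$ of vectors in $\{-1,1\}^\ell$ is a Legendre pair of length $\ell$ if $\mathrm{PAF}_{\mathbf a}(j)+\mathrm{PAF}_{\mathbf b}(j)=-2$ for all $j\in\mathbb{Z}_\ell\setminus\{0\}$ and $\sum_i a_i=\sum_i b_i$. For $\ell=nm$, the $m$-compression of $\mathbf a\in\mathbb{R}^\ell$ is $\mathcal A_m=[A_0,\ldots,A_{n-1}]$ with $A_j=\sum_{i=0}^{m-1}a_{ni+j}$ (here $n=5$). *)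

(* Defs.v *)
From HB Require Import structures.
From mathcomp Require Import all_boot all_order all_algebra.
From mathcomp Require Import complex.
From mathcomp Require Import all_classical all_reals all_analysis.

Set Implicit Arguments.
Unset Strict Implicit.
Unset Printing Implicit Defensive.

Import Order.TTheory GRing.Theory Num.Theory.
Local Open Scope ring_scope.
Local Open Scope complex_scope.

(* The indices of a vector a : 'rV[R]_N are read in Z_N: [entry a k] is the
   entry of a at the residue of k : int modulo N.  The default value 0 is
   reached only for N = 0. *)
Definition entry (R : realType) (N : nat) (a : 'rV[R]_N) (k : int) : R :=
  if insub `|(k %% N%:Z)%Z|%N is Some i then a 0 i else 0.

Definition PAF (R : realType) (N : nat) (a : 'rV[R]_N) (j : int) : R :=
  \sum_(i < N) entry a i%:Z * entry a (i%:Z - j).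

(* [expi t] is e^(i t). *)
Definition expi (R : realType) (t : R) : R[i] := cos t +i* sin t.

Definition DFT (R : realType) (N : nat) (a : 'rV[R]_N) (j : int) : R[i] :=
  \sum_(r < N) expi (2 * pi * (j * r%:Z)%:~R / N%:R) * (entry a r%:Z)%:C.

(* [Normc.normc] is the complex modulus with values in R. *)
Definition PSD (R : realType) (N : nat) (a : 'rV[R]_N) (j : int) : R :=
  ComplexField.Normc.normc (DFT a j) ^+ 2.

Definition compression (R : realType) (n m : nat) (a : 'rV[R]_(n * m)) :
    'rV[R]_n :=
  \row_(j < n) \sum_(i < m) entry a (n * i + j)%N%:Z.

Definition pm1_vector (R : realType) (N : nat) (a : 'rV[R]_N) : Prop :=
  forall i : 'I_N, a 0 i = 1 \/ a 0 i = -1.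

Definition Legendre_pair (R : realType) (l : nat) (a b : 'rV[R]_l) : Prop :=
  [/\ pm1_vector a,
      pm1_vector b,
      forall j : 'I_l, j != 0%N :> nat -> PAF a j%:Z + PAF b j%:Z = -2
    & \sum_(i < l) a 0 i = \sum_(i < l) b 0 i].

(* Main.v *)
(* Since [DFT a (r m)] only depends on the residues of the indices modulo 5, it
   equals [DFT A r] for the m-compression A, and expanding the squared modulus
   gives [PSD A r = sum_k PAF A k cos (2 pi r k / 5)].  For length 5 this is
   [P0 - (P1 + P2) / 2 +/- sqrt 5 (P1 - P2) / 2] with [Pk = PAF A k].  The
   entries of A are sums of m signs with m odd, so they and the Pk are odd integers,
   which makes [n1 = P0 - (P1 + P2) / 2] and [x = (P1 - P2) / 2] integers.
   Summing the Legendre condition over residue classes,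
   [PAF A k + PAF B k] is [8 m + 2] for k = 0 and [- 2 m] for k = 1, 2, whence
   the value of n1 + n2 and the opposite signs of x. *)
Require Import Defs.
From HB Require Import structures.
From mathcomp Require Import all_boot all_order all_algebra.
From mathcomp Require Import complex.
From mathcomp Require Import all_classical all_reals all_analysis.
From mathcomp Require Import ring lra zify.
Import Order.TTheory GRing.Theory Num.Theory.
Local Open Scope ring_scope.

Set Implicit Arguments.
Unset Strict Implicit.
Unset Printing Implicit Defensive.

(** * Periodic functions on the integers and their sums over one period *)

Lemma periodicz (V : zmodType) (f : int -> V) (T : int) :
  periodic f T -> forall q t : int, f (t + q * T) = f t.
Proof.
move=> fT; elim=> [|n IHn|n IHn] t; first by rewrite mul0r addr0.
  by rewrite -addn1 PoszD mulrDl mul1r addrA fT IHn.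
by rewrite -[RHS]IHn -[LHS]fT; congr (f _); lia.
Qed.

Lemma periodic_modz (V : zmodType) (f : int -> V) (T : int) :
  periodic f T -> forall t : int, f (t %% T)%Z = f t.
Proof.
by move=> fT t; rewrite {2}(divz_eq t T) addrC (periodicz fT).
Qed.

Section PeriodicSum.
Variables (V : zmodType) (N : nat) (f : int -> V).
Hypothesis f_periodic : periodic f N%:Z.

Lemma sum_periodic_shift (t : int) :
  \sum_(i < N) f (i%:Z + t) = \sum_(i < N) f i%:Z.
Proof.
have step s : \sum_(i < N) f (i%:Z + (s + 1)) = \sum_(i < N) f (i%:Z + s).
  (* Split off the first of these [N.+1] terms on one side and the last on the other: by periodicity
     both are [f s] and cancel. *)
  have : \sum_(i < N.+1) f (i%:Z + s) = \sum_(i < N.+1) f (i%:Z + s) by [].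
  rewrite {1}big_ord_recl big_ord_recr /= addrC add0r [_%:Z + s]addrC f_periodic.
  move=> /addrI <-; apply: eq_bigr => i _.
  by congr f; rewrite /bump /=; lia.
elim: t => [|n IHn|n IHn]; first by under eq_bigr do rewrite addr0.
  by rewrite -IHn -(step n%:Z); apply: eq_bigr => i _; congr f; lia.
by rewrite -IHn -[LHS]step; apply: eq_bigr => i _; congr f; lia.
Qed.

Lemma sum_periodic_reflect (t : int) :
  \sum_(i < N) f (t - i%:Z) = \sum_(i < N) f i%:Z.
Proof.
(* Reversing the order of summation sends [i] to [N - 1 - i], whence the shift [t - N + 1]. *)
rewrite -(sum_periodic_shift (t - N%:Z + 1)) (reindex_inj rev_ord_inj) /=.
by apply: eq_bigr => i _; congr f; have := ltn_ord i; lia.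
Qed.
End PeriodicSum.

Lemma sum_ord_mul (V : nmodType) (n m : nat) (F : nat -> V) :
  \sum_(i < n * m) F i = \sum_(p < m) \sum_(j < n) F (n * p + j)%N.
Proof.
elim: m F => [|m IHm] F; first by rewrite muln0 !big_ord0.
rewrite big_ord_recr /= -IHm mulnSr big_split_ord /=.
by congr (_ + _); apply: eq_bigr.
Qed.

(** * Compression and periodic autocorrelation *)

Section Compression.
Variables (R : realType).
Implicit Types N n m : nat.

Lemma entry_ord N (a : 'rV[R]_N) (i : 'I_N) : entry a i%:Z = a 0 i.
Proof.
rewrite /entry modz_small ?ltz_nat ?ltn_ord //=.
by rewrite (valK i).
Qed.

Lemma entry_periodic N (a : 'rV[R]_N) : periodic (entry a) N%:Z.
Proof. by move=> t; rewrite /entry modzDr. Qed.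

(** As functions of [t] both sides have period [n]: moving [t] by [n] moves [s] by 1 in a summand of
    period [m]. This leaves [0 <= t < n], where the definition applies. *)
Lemma entry_compression n m (a : 'rV[R]_(n * m)) (t : int) : (0 < n)%N ->
  entry (compression a) t = \sum_(s < m) entry a (t + n%:Z * s%:Z).
Proof.
move=> n0; pose g (u : int) : R := \sum_(s < m) entry a (u + n%:Z * s%:Z).
have gP : periodic g n%:Z.
  move=> u; pose h (s : int) : R := entry a (u + n%:Z * s).
  have hP : periodic h m%:Z.
    by move=> s; rewrite /h mulrDr addrA -PoszM entry_periodic.
  rewrite /g -[RHS](sum_periodic_shift hP 1); apply: eq_bigr => s _.
  by congr entry; lia.
rewrite -[RHS]/(g t) -(periodic_modz gP) -(periodic_modz (entry_periodic _)).
have t0 : 0 <= (t %% n)%Z by rewrite modz_ge0 //; lia.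
have tn : (`|(t %% n)%Z| < n)%N by have := ltz_pmod t (d := n%:Z); lia.
rewrite -(gez0_abs t0) -[`|_|%N]/(nat_of_ord (Ordinal tn)) entry_ord mxE.
by apply: eq_bigr => s _; congr entry; rewrite /=; lia.
Qed.

Lemma PAF_periodic N (a : 'rV[R]_N) : periodic (PAF a) N%:Z.
Proof.
move=> k; apply: eq_bigr => i _; congr (_ * _).
by rewrite -[LHS]entry_periodic; congr entry; lia.
Qed.

Lemma PAF_opp N (a : 'rV[R]_N) (k : int) : PAF a (- k) = PAF a k.
Proof.
pose f (i : int) := entry a i * entry a (i - k).
have fP : periodic f N%:Z.
  by move=> i; rewrite /f addrAC !entry_periodic.
rewrite /PAF -[RHS](sum_periodic_shift fP k); apply: eq_bigr => i _.
by rewrite /f addrK opprK mulrC.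
Qed.

(** With [i = n * p + j], both sides become sums over [j], [p], [s] of products of two entries of
    [a]; for fixed [j] and [p] they differ by the substitution of [p - s] for [s]. *)
Lemma PAF_compression n m (a : 'rV[R]_(n * m)) (k : int) : (0 < n)%N ->
  PAF (compression a) k = \sum_(s < m) PAF a (k + n%:Z * s%:Z).
Proof.
move=> n0; rewrite /PAF exchange_big /=.
pose F (i : nat) := \sum_(s < m) entry a i%:Z * entry a (i%:Z - (k + n%:Z * s%:Z)).
rewrite [RHS](sum_ord_mul _ _ F) exchange_big; apply: eq_bigr => j _.
rewrite !entry_compression // mulr_suml; apply: eq_bigr => p _.
rewrite /F -mulr_sumr; congr (entry a _ * _); first by lia.
pose h (s : int) : R := entry a (j%:Z - k + n%:Z * s).
have hP : periodic h m%:Z.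
  by move=> s; rewrite /h mulrDr addrA -PoszM entry_periodic.
rewrite -(sum_periodic_reflect hP p%:Z); apply: eq_bigr => s _.
by congr entry; lia.
Qed.
End Compression.

(** * Fourier transform and power spectrum *)

Section Fourier.
Variables (R : realType).
Implicit Types N n m : nat.
Local Open Scope complex_scope.

Lemma expi_periodic : periodic (@expi R) (2 * pi).
Proof.
by move=> t; rewrite /expi [2 * pi]mulrC mulr_natr cosD2pi sinD2pi.
Qed.

Lemma expi_angle_periodic N : (0 < N)%N ->
  periodic (fun k : int => @expi R (2 * pi * k%:~R / N%:R)) N%:Z.
Proof.
move=> N0 k; rewrite -[RHS]expi_periodic; congr expi.
by rewrite intrD; field; rewrite pnatr_eq0; lia.
Qed.

Lemma cos_angle_periodic N : (0 < N)%N ->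
  periodic (fun k : int => cos (2 * pi * k%:~R / N%:R) : R) N%:Z.
Proof. by move=> N0 k; have [] := expi_angle_periodic N0 k. Qed.

Lemma DFT_compression n m (a : 'rV[R]_(n * m)) (j : int) :
  (0 < n)%N -> (0 < m)%N -> DFT a (j * m%:Z) = DFT (compression a) j.
Proof.
move=> n0 m0; rewrite /DFT.
rewrite (sum_ord_mul _ _ (fun r : nat => expi (2 * pi * (j * m%:Z * r%:Z)%:~R
   / (n * m)%:R) * (entry a r%:Z)%:C)) exchange_big.
apply: eq_bigr => q _; rewrite entry_compression // rmorph_sum mulr_sumr.
apply: eq_bigr => p _; congr (_ * (entry a _)%:C); last by lia.
(* For [r = n * p + q] the angle is that of [j * q] over [n] plus [j * p] full turns. *)
rewrite -[RHS](periodicz (expi_angle_periodic n0) (j * p%:Z)).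
congr expi; rewrite !(PoszM, PoszD, intrM, intrD, natrM) /=.
rewrite -!pmulrn; field; rewrite !pnatr_eq0; lia.
Qed.

Lemma PSD_cos_sin N (a : 'rV[R]_N) (j : int) :
  PSD a j = (\sum_(r < N) cos (2 * pi * (j * r%:Z)%:~R / N%:R) * entry a r%:Z) ^+ 2
          + (\sum_(r < N) sin (2 * pi * (j * r%:Z)%:~R / N%:R) * entry a r%:Z) ^+ 2.
Proof.
rewrite /PSD.
have -> : DFT a j = (\sum_(r < N) cos (2 * pi * (j * r%:Z)%:~R / N%:R) * entry a r%:Z) +i*
   (\sum_(r < N) sin (2 * pi * (j * r%:Z)%:~R / N%:R) * entry a r%:Z).
  apply/eqP; rewrite eq_complex /DFT !raddf_sum /=; apply/andP; split; apply/eqP;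
    by apply: eq_bigr => r _; rewrite /expi /= !(mulr0, subr0, add0r).
by rewrite /= sqr_sqrtr // addr_ge0 ?sqr_ge0.
Qed.

(** The two squares expand into products of cosines and of sines, which combine by the formula for
    the cosine of a difference. Substituting [i - k] for [k] then collects the terms by the
    difference of their indices. *)
Lemma PSD_PAF N (a : 'rV[R]_N) (j : int) : (0 < N)%N ->
  PSD a j = \sum_(k < N) PAF a k%:Z * cos (2 * pi * (j * k%:Z)%:~R / N%:R).
Proof.
move=> N0; rewrite PSD_cos_sin !expr2 !mulr_suml -big_split /=.
under [RHS]eq_bigr do rewrite /PAF mulr_suml.
rewrite [RHS]exchange_big; apply: eq_bigr => i _ /=.
rewrite !mulr_sumr -big_split /=.
pose f (k : int) : R := entry a i%:Z * entry a k
  * cos (2 * pi * (j * (i%:Z - k))%:~R / N%:R).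
have fP : periodic f N%:Z.
  move=> k; rewrite /f entry_periodic.
  rewrite -(periodicz (cos_angle_periodic N0) j); congr (_ * cos _).
  by congr (2 * pi * _%:~R / _); lia.
transitivity (\sum_(k < N) f k%:Z).
  apply: eq_bigr => k _; rewrite /f mulrBr intrB mulrBr mulrBl cosB; ring.
rewrite -(sum_periodic_reflect fP i%:Z); apply: eq_bigr => k _.
by rewrite /f subKr.
Qed.

(** With [c] the cosine of the angle t = 2 pi / 5, cos (4 t) = cos t is a quartic equation in [c].
    The bounds [0 < c < 1] exclude its roots 1 and -1/2 and select the positive root of the
    remaining quadratic factor. *)
Lemma cos_2pi5 : cos (2 * pi / 5 : R) = (Num.sqrt 5 - 1) / 4.
Proof.
set c := cos _; have pi0 := pi_gt0 R.
have c_gt0 : 0 < c by apply: cos_gt0_pihalf; apply/andP; split; lra.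
have s_gt0 : 0 < sin (2 * pi / 5 : R) by apply: sin_gt0_pi; apply/andP; split; lra.
have c_lt1 : c < 1 by have := cos2Dsin2 (2 * pi / 5 : R); rewrite -/c; nra.
have c_eq : 2 * (2 * c ^+ 2 - 1) ^+ 2 - 1 = c.
  have -> : 2 * (2 * c ^+ 2 - 1) ^+ 2 - 1 = cos ((2 * pi / 5 : R) *+ 2 *+ 2).
    by rewrite !cos_mulr2n -/c; ring.
  by rewrite -[RHS]cosN -[RHS]cosD2pi; congr cos; field.
have /eqP : (c - 1) * (2 * c + 1) * ((4 * c + 1) ^+ 2 - 5) = 0.
  transitivity (4 * ((2 * (2 * c ^+ 2 - 1) ^+ 2 - 1) - c)); first by ring.
  by rewrite c_eq subrr mulr0.
rewrite !mulf_eq0 => /orP[/orP[]/eqP|]; [lra|lra|].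
rewrite subr_eq0 => /eqP <-; rewrite sqrtr_sqr ger0_norm; last by lra.
by field.
Qed.

Lemma cos_4pi5 : cos (4 * pi / 5 : R) = (- Num.sqrt 5 - 1) / 4.
Proof.
have -> : 4 * pi / 5 = (2 * pi / 5) *+ 2 :> R by rewrite -mulr_natr; field.
rewrite cos_mulr2n cos_2pi5 -mulr_natr.
have := @sqr_sqrtr R 5 ltac:(by []); set s := Num.sqrt _ => h.
by rewrite expr_div_n sqrrB h; field.
Qed.


Lemma PSD_length5 (a : 'rV[R]_5) (r : nat) : (1 <= r <= 4)%N ->
  PSD a r%:Z = PAF a 0 - (PAF a 1 + PAF a 2) / 2
    + (-1) ^+ (r %/ 2) * Num.sqrt 5 * ((PAF a 1 - PAF a 2) / 2).
Proof.
move=> r14; rewrite PSD_PAF //.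
pose c (k : int) : R := cos (2 * pi * k%:~R / 5).
have c0 : c 0 = 1 by rewrite /c mulr0 mul0r cos0.
have c1 : c 1 = (Num.sqrt 5 - 1) / 4 by rewrite /c mulr1 cos_2pi5.
have c2 : c 2 = (- Num.sqrt 5 - 1) / 4.
  by rewrite /c -cos_4pi5; congr cos; field.
have cN k : c (- k) = c k by rewrite /c rmorphN mulrN mulNr cosN.
have cP k q : c (k + q * 5) = c k.
  exact: (periodicz (cos_angle_periodic (isT : 0 < 5)%N)) q k.
(* Evenness and period 5 reduce [PAF] to the arguments 0, 1, 2, and likewise [c] at every product
   [r * k] with [r, k <= 4]. For [r] = 2, 3 the values [c 1] and [c 2] trade places, which flips the
   sign of the square root. *)
have P3 : PAF a 3 = PAF a 2 by rewrite -PAF_opp -(PAF_periodic a (- 3)).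
have P4 : PAF a 4 = PAF a 1 by rewrite -PAF_opp -(PAF_periodic a (- 4)).
have c3 : c 3 = c 2 by rewrite -cN -(cP (- 3) 1).
have c4 : c 4 = c 1 by rewrite -cN -(cP (- 4) 1).
have c6 : c 6 = c 1 by rewrite -(cP 1 1).
have c8 : c 8 = c 2 by rewrite -c3 -(cP 3 1).
have c9 : c 9 = c 1 by rewrite -c4 -(cP 4 1).
have c12 : c 12 = c 2 by rewrite -(cP 2 2).
have c16 : c 16 = c 1 by rewrite -(cP 1 3).
have step k : PAF a k%:Z * cos (2 * pi * (r%:Z * k%:Z)%:~R / 5%:R) = PAF a k%:Z * c (r * k)%N%:Z.
  by rewrite PoszM.
rewrite !big_ord_recr big_ord0 /= !step P3 P4 muln0 muln1 c0 {step}.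
move: r r14 => [|[|[|[|[|r]]]]] // _;
  by rewrite /= ?(c3, c4, c6, c8, c9, c12, c16) c1 c2; field.
Qed.

End Fourier.

(** * Parity of the autocorrelations *)

Section OddIntegers.
Variables (R : realType).

Definition odd_integer (x : R) := exists z : int, x = (2 * z + 1)%:~R.

Lemma odd_integerM (x y : R) :
  odd_integer x -> odd_integer y -> odd_integer (x * y).
Proof.
move=> [u ->] [v ->]; exists (2 * u * v + u + v).
by rewrite -intrM; congr _%:~R; ring.
Qed.

Lemma odd_integer_sum (m : nat) (F : 'I_m -> R) : odd m ->
  (forall i, odd_integer (F i)) -> odd_integer (\sum_(i < m) F i).
Proof.
(* The [m] summands 1 add up to [m = 2 * m./2 + 1]. *)
move=> m_odd /choice [z Fz]; exists (\sum_(i < m) z i + m./2%:Z).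
rewrite (eq_bigr _ (fun i _ => Fz i)) -rmorph_sum big_split /= -mulr_sumr.
congr _%:~R; rewrite sumr_const card_ord.
rewrite (natz m) mulrDr -addrA; congr (_ + _).
by have := odd_double_half m; rewrite m_odd; lia.
Qed.

Lemma odd_integer_PAF (N : nat) (a : 'rV[R]_N) (k : int) : odd N ->
  (forall t, odd_integer (entry a t)) -> odd_integer (PAF a k).
Proof. by move=> N_odd ha; apply: odd_integer_sum => // i; apply: odd_integerM. Qed.

(** [0 < N] rules out the default value 0 of [entry], which is not odd. *)
Lemma odd_integer_entry_pm1 (N : nat) (a : 'rV[R]_N) (t : int) : (0 < N)%N ->
  pm1_vector a -> odd_integer (entry a t).
Proof.
move=> N0 ha; rewrite -(periodic_modz (entry_periodic a)).
have t0 : 0 <= (t %% N)%Z by rewrite modz_ge0 //; lia.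
have tN : (`|(t %% N)%Z| < N)%N by have := ltz_pmod t (d := N%:Z); lia.
rewrite -(gez0_abs t0) -[`|_|%N]/(nat_of_ord (Ordinal tN)) entry_ord.
by case: (ha (Ordinal tN)) => ->; [exists 0 | exists (-1)].
Qed.

Lemma odd_integer_PAF_compression (n m : nat) (a : 'rV[R]_(n * m)) (k : int) :
  odd n -> odd m -> pm1_vector a -> odd_integer (PAF (compression a) k).
Proof.
move=> n_odd m_odd ha; apply: odd_integer_PAF => // t.
rewrite entry_compression ?odd_gt0 //; apply: odd_integer_sum => // s.
by apply: odd_integer_entry_pm1; rewrite ?muln_gt0 ?odd_gt0.
Qed.

End OddIntegers.

(** * The Legendre condition on compressions, and the theorem *)

Lemma PAF0_pm1 (R : realType) (N : nat) (a : 'rV[R]_N) :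
  pm1_vector a -> PAF a 0 = N%:R.
Proof.
move=> ha; rewrite /PAF -[N in RHS]card_ord -sumr_const; apply: eq_bigr => i _.
by rewrite subr0 entry_ord; case: (ha i) => ->; rewrite ?mulrNN mulr1.
Qed.

Lemma Legendre_PAF_compression (R : realType) (n m : nat)
    (a b : 'rV[R]_(n * m)) (k : nat) : (0 < k < n)%N -> Legendre_pair a b ->
  PAF (compression a) k%:Z + PAF (compression b) k%:Z = - 2 * m%:R.
Proof.
move=> /andP[k0 kn] [_ _ hab _]; have n0 : (0 < n)%N by lia.
rewrite !PAF_compression // -big_split /= mulr_natr -[m in RHS]card_ord -sumr_const.
apply: eq_bigr => s _.
have sn : (k + n * s < n * m)%N by have := ltn_ord s; nia.
by rewrite -PoszM -PoszD (hab (Ordinal sn)) //=; lia.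
Qed.

Lemma Legendre_PAF0_compression (R : realType) (n m : nat)
    (a b : 'rV[R]_(n * m)) : (0 < n)%N -> (0 < m)%N -> Legendre_pair a b ->
  PAF (compression a) 0 + PAF (compression b) 0
    = 2 * (n * m)%:R - 2 * m.-1%:R.
Proof.
case: m a b => // m a b n0 _ [ha hb hab _].
(* The shift [s = 0] gives [2 * (n * m)]; the other [m.-1] shifts give -2 each. *)
rewrite !PAF_compression // -big_split big_ord_recl /= mulr0 addr0 !PAF0_pm1 //.
rewrite (eq_bigr (fun=> - 2)) => [|s _].
  by rewrite sumr_const card_ord -mulr_natr; ring.
have sn : (n * (bump 0 s) < n * m.+1)%N.
  by rewrite ltn_pmul2l // /bump /=; have := ltn_ord s; lia.
by rewrite add0r -PoszM (hab (Ordinal sn)) //= /bump; lia.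
Qed.

Theorem proposition1 (R : realType) (m : nat) (m_odd : odd m)
    (a b : 'rV[R]_(5 * m)) (ab_Legendre : Legendre_pair a b)
    (sum_a : \sum_(i < 5 * m) a 0 i = 1)
    (sum_b : \sum_(i < 5 * m) b 0 i = 1) :
  exists n1 n2 x : int,
    [/\ 0 <= n1, 0 <= n2, n1 + n2 = (2 * (5 * m) + 2)%N%:Z,
        x%:~R = (PAF (compression a) 1 - PAF (compression a) 2) / 2 :> R /\
        x%:~R = - ((PAF (compression b) 1 - PAF (compression b) 2) / 2) :> R
      & forall r : nat, (1 <= r <= 4)%N ->
          PSD a (r * m)%N%:Z
            = n1%:~R + (-1) ^+ (r %/ 2) * Num.sqrt 5 * x%:~R /\
          PSD b (r * m)%N%:Z
            = n2%:~R - (-1) ^+ (r %/ 2) * Num.sqrt 5 * x%:~R].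
Proof.
have m0 : (0 < m)%N by rewrite odd_gt0.
have [ha hb _ _] := ab_Legendre.
have PSDE (c : 'rV[R]_(5 * m)) r (r14 : (1 <= r <= 4)%N) := PSD_length5 (compression c) r14.
have PSDm (c : 'rV[R]_(5 * m)) (r : nat) :
    PSD c (r * m)%N%:Z = PSD (compression c) r%:Z.
  by rewrite /PSD PoszM DFT_compression.
have n_ge0 (c : 'rV[R]_(5 * m)) : 0 <= PAF (compression c) 0
    - (PAF (compression c) 1 + PAF (compression c) 2) / 2.
  have PSD_ge0 r : 0 <= PSD (compression c) r by apply: sqr_ge0.
  (* The square root has opposite signs at [r] = 1 and 2, so it cancels and the sum is twice the
     claimed quantity. *)
  have := addr_ge0 (PSD_ge0 1) (PSD_ge0 2).
  by rewrite !PSDE //= expr0 expr1; lra.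
have PAFz (c : 'rV[R]_(5 * m)) k : pm1_vector c -> odd_integer (PAF (compression c) k).
  exact: odd_integer_PAF_compression.
have s0 := Legendre_PAF0_compression (isT : 0 < 5)%N m0 ab_Legendre.
have s1 := Legendre_PAF_compression (isT : 0 < 1 < 5)%N ab_Legendre.
have s2 := Legendre_PAF_compression (isT : 0 < 2 < 5)%N ab_Legendre.
have m1 : m.-1%:R = m%:R - 1 :> R by rewrite -subn1 natrB.
have nE (x y z : int) : (2 * x + 1)%:~R - ((2 * y + 1)%:~R + (2 * z + 1)%:~R) / 2
    = (2 * x - y - z)%:~R :> R.
  by rewrite !(intrD, intrB, intrM) /=; field.
have xE (y z : int) : ((2 * y + 1)%:~R - (2 * z + 1)%:~R) / 2 = (y - z)%:~R :> R.
  by rewrite !(intrD, intrB, intrM) /=; field.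
move: (n_ge0 a) (n_ge0 b) (PSDE a) (PSDE b) s0 s1 s2.
have [u0 ->] := PAFz a 0 ha; have [u1 ->] := PAFz a 1 ha; have [u2 ->] := PAFz a 2 ha.
have [v0 ->] := PAFz b 0 hb; have [v1 ->] := PAFz b 1 hb; have [v2 ->] := PAFz b 2 hb.
rewrite !nE !xE !ler0z => na nb Ea Eb s0 s1 s2.
(* [s1] and [s2] have the same right-hand side; subtract them. *)
have xab : (u1 - u2)%:~R = - (v1 - v2)%:~R :> R.
  by move: s1 s2; rewrite !(intrD, intrB, intrM); lra.
exists (2 * u0 - u1 - u2), (2 * v0 - v1 - v2), (u1 - u2).
split=> // [|r r14].
  (* The sum is [s0] minus half of [s1] plus [s2], that is [(8 m + 2) + 2 m]. *)
  apply: (@intr_inj R); move: s0 s1 s2.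
  rewrite m1 -pmulrn !(intrD, intrB, intrM, natrD, natrM); lra.
by rewrite !PSDm Ea // Eb // xab mulrN opprK.
Qed.
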